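(* (i) The set of possible values of $\alpha(A)$ is $(-1,1]$, i.e. $$(-1,1]=\bigcup_{N\in\mathbb{N},\,\mathfrak{C}>1}\{\alpha(A):A\in\mathrm{Crit}_{N,\mathfrak{C}}\}.$$ (ii) Restricted to normal matrices, the set of possible values of $\alpha(A)$ is $[-1/3,1]$, i.e. $$[-1/3,1]=\bigcup_{N\in\mathbb{N},\,\mathfrak{C}>1}\{\alpha(A):A\in\mathrm{Crit}_{N,\mathfrak{C}},\ AA^*=A^*A\}.$$ (iii) Restricted to Hermitian matrices, the value of $\alpha(A)$ is always $-1/3$, i.e. $$\{-1/3\}=\bigcup_{N\in\mathbb{N},\,\mathfrak{C}>1}\{\alpha(A):A\in\mathrm{Crit}_{N,\mathfrak{C}},\ A=A^*\}.$$ Moreover, among normal matrices $A\in\bigcup_{N,\mathfrak{C}}\mathrm{Crit}_{N,\mathfrak{C}}$, one has $\alpha(A)=-1/3$ if and only if $A=e^{\mathrm{i}\varphi}A^*$ for some $\varphi\in[0,2\pi)$.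
   Context: Notation: for a $d\times d$ matrix $B$, $\langle B\rangle:=d^{-1}\mathrm{Tr}\,B$ and $|B|:=\sqrt{B^*B}$; $\|\cdot\|$ is the operator norm. For $\mathfrak{C}>1$, $\mathrm{Crit}_{N,\mathfrak{C}}$ is the set of $A\in\mathbb{C}^{N\times N}$ with (i) $\|A\|\le\mathfrak{C}$, $\|A^{-1}\|\le\mathfrak{C}$; (ii) $\langle|A|^{-2}\rangle=1$; (iii) $\langle A^{-2}(A^* )^{-1}\rangle=0$. For $A\in\mathrm{Crit}_{N,\mathfrak{C}}$ let $\mathcal{H}\in\mathbb{R}^{2\times2}$ be the Hessian at the origin of the real-valued function $(x,y)\mapsto\langle|A-x-\mathrm{i}y|^{-2}\rangle$ (defined near the origin), with eigenvalues $\lambda_1\ge\lambda_2$. The shape parameter is $\alpha(A):=\lambda_2/\lambda_1$. *)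

(* Defs.v *)
From HB Require Import structures.
From mathcomp Require Import all_boot all_order all_algebra.
From mathcomp Require Import complex.
From mathcomp Require Import all_classical all_reals all_analysis.

Set Implicit Arguments.
Unset Strict Implicit.
Unset Printing Implicit Defensive.

Import Order.TTheory GRing.Theory Num.Theory.
Import numFieldNormedType.Exports.

Local Open Scope classical_set_scope.
Local Open Scope ring_scope.
Local Open Scope complex_scope.
Local Open Scope sesquilinear_scope.

Section Crit.
Variable R : realType.
Local Notation C := R[i].

Definition ntr N (B : 'M[C]_N) : C := N%:R^-1 * \tr B.

(* |B| = sqrt(B^* B), by functional calculus: B^* B is Hermitian positive
   semidefinite, hence unitarily diagonalized by its [spectralmx]. *)
Definition absmx N (B : 'M[C]_N) : 'M[C]_N :=
  let H := B ^t* *m B in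
  invmx (spectralmx H) *m diag_mx (map_mx sqrtC (spectral_diag H))
    *m spectralmx H.

Lemma absmx_sqr N (B : 'M[C]_N) : absmx B *m absmx B = B ^t* *m B.
Proof.
rewrite /absmx; set H := B ^t* *m B.
have Hherm : H ^t* = H.
  by rewrite /H trmx_mul map_mxM trmxCK.
have /orthomx_spectralP HE : H \is normalmx by apply/normalmxP; rewrite Hherm.
rewrite [RHS]HE !mulmxA; congr (_ *m _).
rewrite -!mulmxA (mulmxA (spectralmx H)) mulmxV ?spectral_unit// mul1mx.
rewrite mulmx_diag; congr (_ *m diag_mx _).
by apply/rowP => j; rewrite !mxE -expr2 sqrtCK.
Qed.

Definition absmx_expN2 N (B : 'M[C]_N) : 'M[C]_N :=
  invmx (absmx B) *m invmx (absmx B).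

Definition l2norm N (v : 'cV[C]_N) : R := Num.sqrt (\sum_i complex.Re `|v i 0| ^+ 2).

Definition opnorm N (B : 'M[C]_N) : R :=
  sup [set l2norm (B *m v) | v in [set v : 'cV[C]_N | l2norm v <= 1]].

(* Invertibility, implicit in the bound on the inverse, is required explicitly
   because [invmx A] is [A] when [A] is singular. *)
Definition Crit N (c : R) : set 'M[C]_N :=
  [set A | [/\ A \in unitmx, opnorm A <= c, opnorm (invmx A) <= c,
               ntr (absmx_expN2 A) = 1
             & ntr (invmx A *m invmx A *m invmx (A ^t*)) = 0]].

Definition hessian n (f : 'rV[R]_n.+1 -> R) (a : 'rV[R]_n.+1) : 'M[R]_n.+1 :=
  \matrix_(i, j) 'D_('e_i) (fun z => 'D_('e_j) (f : _ -> R^o) z) a.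

(* The trace below is real, so [complex.Re] only changes the codomain. *)
Definition shape_fun N (A : 'M[C]_N) (z : 'rV[R]_2) : R :=
  complex.Re (ntr (absmx_expN2 (A - (z 0 0 +i* z 0 1)%:M))).

Definition shape_hessian N (A : 'M[C]_N) : 'M[R]_2 := hessian (shape_fun A) 0.

(* A real symmetric 2 x 2 matrix has one or two eigenvalues, all real, so its
   ordered eigenvalues lambda1 >= lambda2 are the largest and the smallest. *)
Definition lambda1 (H : 'M[R]_2) : R := sup [set l | eigenvalue H l].
Definition lambda2 (H : 'M[R]_2) : R := inf [set l | eigenvalue H l].

Definition alpha N (A : 'M[C]_N) : R :=
  lambda2 (shape_hessian A) / lambda1 (shape_hessian A).

Definition expi (phi : R) : C := cos phi +i* sin phi.

End Crit.

Arguments Crit {R} N c.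

(* Main.v *)
(* With M = A^-1, expanding the resolvent (A - z)^-1 to second order gives
   <|A - z|^-2> = 1 + p |z|^2 + 2 Re (q z^2) + o(|z|^2), where p = <M^2 (M^2)^*>
   and q = <M^3 M^*>.  The Hessian thus has eigenvalues 2p +- 4|q|, and
   alpha = (p - 2|q|) / (p + 2|q|) with p > 0.

   For normal M, q is the inner product of M^2 and M M^*, both of squared norm p,
   so |q| <= p by Cauchy-Schwarz, with equality iff M is a phase times M^*.

   The ratios |q|/p in [0, 1] are attained by the diagonal matrices with spectrum
   u, -u, u^*, -u^* on the unit circle; those in [1, +oo) by antidiagonal 2 x 2
   matrices M with M^2 = s, s in (0, 1], for which |q|/p = 1/s. *)
Require Import Defs.
From HB Require Import structures.
From mathcomp Require Import all_boot all_order all_algebra.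
From mathcomp Require Import complex.
From mathcomp Require Import all_classical all_reals all_analysis.
From mathcomp Require Import ring lra.
Import Order.TTheory GRing.Theory Num.Theory.
Import numFieldNormedType.Exports.

Set Implicit Arguments.
Unset Strict Implicit.
Unset Printing Implicit Defensive.

Local Open Scope classical_set_scope.
Local Open Scope ring_scope.
Local Open Scope sesquilinear_scope.

(** * Adjoints, inverses and the normalized trace *)

Section AdjointTrace.
Variable R : realType.
Local Notation C := R[i].

Lemma adjmxM m n p (A : 'M[C]_(m, n)) (B : 'M[C]_(n, p)) :
  (A *m B) ^t* = B ^t* *m A ^t*.
Proof. by rewrite trmx_mul map_mxM. Qed.

Lemma adjmxB m n (A B : 'M[C]_(m, n)) : (A - B) ^t* = A ^t* - B ^t*.
Proof. by apply/matrixP => i j; rewrite !mxE rmorphB. Qed.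

Lemma adjmxZ m n a (A : 'M[C]_(m, n)) : (a *: A) ^t* = a^* *: A ^t*.
Proof. by apply/matrixP => i j; rewrite !mxE rmorphM. Qed.

Lemma invmx_adj n (A : 'M[C]_n) : invmx (A ^t*) = (invmx A) ^t*.
Proof. by rewrite trmx_inv map_invmx. Qed.

Lemma adjmx_unit n (A : 'M[C]_n) : (A ^t* \in unitmx) = (A \in unitmx).
Proof. by rewrite map_unitmx unitmx_tr. Qed.

Lemma invmxM n (A B : 'M[C]_n) : A \in unitmx -> B \in unitmx ->
  invmx (A *m B) = invmx B *m invmx A.
Proof.
move=> uA uB; have uAB : A *m B \in unitmx by rewrite unitmx_mul uA uB.
by apply: (can_inj (mulmxK uAB)); rewrite mulVmx// mulmxA mulmxKV// mulVmx.
Qed.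

(** Since |B|^2 = B^* B, the square root cancels and |B|^-2 = B^-1 (B^-1)^*. From here on only the
    inverse and its adjoint occur; [absmx B] is invertible because its square is. *)
Lemma absmx_expN2E n (B : 'M[C]_n) : B \in unitmx ->
  absmx_expN2 B = invmx B *m (invmx B) ^t*.
Proof.
move=> uB; rewrite /absmx_expN2.
have uabs : absmx B \in unitmx.
  have : absmx B *m absmx B \in unitmx.
    by rewrite absmx_sqr unitmx_mul adjmx_unit uB.
  by rewrite unitmx_mul => /andP[].
by rewrite -invmxM// absmx_sqr invmxM ?adjmx_unit// invmx_adj.
Qed.

Lemma ntrD n (A B : 'M[C]_n) : ntr (A + B) = ntr A + ntr B.
Proof. by rewrite /ntr mxtraceD mulrDr. Qed.

Lemma ntrN n (A : 'M[C]_n) : ntr (- A) = - ntr A.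
Proof. by rewrite /ntr raddfN mulrN. Qed.

Lemma ntrZ n a (A : 'M[C]_n) : ntr (a *: A) = a * ntr A.
Proof. by rewrite /ntr mxtraceZ mulrCA. Qed.

Lemma ntr_adj n (A : 'M[C]_n) : ntr (A ^t*) = (ntr A)^*.
Proof.
rewrite /ntr rmorphM fmorphV rmorph_nat; congr (_ * _).
by rewrite /mxtrace raddf_sum; apply: eq_bigr => i _; rewrite !mxE.
Qed.

(** The normalized squared Hilbert-Schmidt norm, from which positivity and definiteness are read
    off. *)
Lemma ntr_mulmx_adj n (X : 'M[C]_n) :
  ntr (X *m X ^t*) = n%:R^-1 * \sum_i \sum_j `|X i j| ^+ 2.
Proof.
congr (_ * _); apply: eq_bigr => i _; rewrite mxE; apply: eq_bigr => j _.
by rewrite !mxE normCK.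
Qed.

Lemma ntr_mulmx_adj_ge0 n (X : 'M[C]_n) : 0 <= ntr (X *m X ^t*).
Proof.
rewrite ntr_mulmx_adj mulr_ge0 ?invr_ge0 ?ler0n// sumr_ge0// => i _.
by rewrite sumr_ge0// => j _; rewrite exprn_ge0.
Qed.

Lemma ntr_mulmx_adj_eq0 n (X : 'M[C]_n) : ntr (X *m X ^t*) = 0 -> X = 0.
Proof.
(* In size 0 the factor [n%:R^-1] is 0 and cannot be cancelled, but the matrix is empty. *)
case: n X => [|n] X; first by move=> _; apply/matrixP => -[].
rewrite ntr_mulmx_adj => /eqP; rewrite mulf_eq0 invr_eq0 pnatr_eq0/= => /eqP X0.
apply/matrixP => i j; rewrite mxE; apply/eqP; rewrite -normr_eq0 -sqrf_eq0.
have ge0 k l : 0 <= `|X k l| ^+ 2 by rewrite exprn_ge0.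
have ge0s k : true -> 0 <= \sum_l `|X k l| ^+ 2.
  by move=> _; rewrite sumr_ge0.
have row0 := @psumr_eq0P _ _ _ _ (fun l _ => ge0 i l) (@psumr_eq0P _ _ _ _ ge0s X0 i isT).
by rewrite row0.
Qed.

Lemma complex_ge0_Re (z : C) : 0 <= z -> z = (complex.Re z)%:C%C.
Proof. by move=> /ger0_Im; case: z => x y /= ->. Qed.

Lemma ntr_mulmx_adj_real n (X : 'M[C]_n) :
  ntr (X *m X ^t*) = (complex.Re (ntr (X *m X ^t*)))%:C%C.
Proof. exact/complex_ge0_Re/ntr_mulmx_adj_ge0. Qed.

End AdjointTrace.

(** * Limits of complex-valued functions *)

Section ComplexLimits.
Variable R : realType.
Local Notation C := R[i].

(* Convergence in [R[i]] is encoded by that of real and imaginary parts: the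
   library topology on [R[i]] is not a topology of modules over [R]. *)
Definition cvgC (F : set_system R) (f : R -> C) (l : C) : Prop :=
  complex.Re (f t) @[t --> F] --> complex.Re l /\
  complex.Im (f t) @[t --> F] --> complex.Im l.

Context {F : set_system R} {FF : Filter F}.
Implicit Types (f g : R -> C) (l k : C).

Lemma cvgC_cst l : cvgC F (fun=> l) l.
Proof. by split; exact: cvg_cst. Qed.

Lemma cvgCD f g l k : cvgC F f l -> cvgC F g k ->
  cvgC F (fun t => f t + g t) (l + k).
Proof.
rewrite /cvgC; case: l => a b; case: k => c d /= -[fa fb] [gc gd]; split.
  under eq_fun do rewrite raddfD/=; exact: cvgD.
under eq_fun do rewrite raddfD/=; exact: cvgD.
Qed.

Lemma ReM (x y : C) : complex.Re (x * y) =
  complex.Re x * complex.Re y - complex.Im x * complex.Im y.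
Proof. by case: x => a b; case: y. Qed.

Lemma ImM (x y : C) : complex.Im (x * y) =
  complex.Re x * complex.Im y + complex.Im x * complex.Re y.
Proof. by case: x => a b; case: y. Qed.

Lemma cvgCM f g l k : cvgC F f l -> cvgC F g k ->
  cvgC F (fun t => f t * g t) (l * k).
Proof.
rewrite /cvgC; move=> -[fa fb] [gc gd]; split.
  under eq_fun do rewrite ReM; rewrite ReM.
  by apply: cvgB; exact: cvgM.
under eq_fun do rewrite ImM; rewrite ImM.
by apply: cvgD; exact: cvgM.
Qed.

Lemma cvgC_conj f l : cvgC F f l -> cvgC F (fun t => (f t)^*) l^*.
Proof.
have RE (x : C) : complex.Re x^* = complex.Re x by case: x.
have IE (x : C) : complex.Im x^* = - complex.Im x by case: x.
move=> [fa fb]; split.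
  by under eq_fun do rewrite RE; rewrite RE.
by under eq_fun do rewrite IE; rewrite IE; exact: cvgN.
Qed.

(** In coordinates the inverse is the conjugate divided by the squared modulus, and the latter does
    not vanish at the limit. *)
Lemma cvgCV f l : l != 0 -> cvgC F f l -> cvgC F (fun t => (f t)^-1) l^-1.
Proof.
have RE (x : C) : complex.Re x^-1 =
  complex.Re x * (complex.Re x ^+ 2 + complex.Im x ^+ 2)^-1 by case: x.
have IE (x : C) : complex.Im x^-1 =
  - (complex.Im x * (complex.Re x ^+ 2 + complex.Im x ^+ 2)^-1) by case: x.
move=> l0 [fa fb].
have n0 : complex.Re l ^+ 2 + complex.Im l ^+ 2 != 0.
  move: l0; case: (l) => a b /=; apply: contraNneq => /eqP.
  rewrite paddr_eq0 ?sqr_ge0// !sqrf_eq0 => /andP[/eqP-> /eqP->].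
  by [].
have fn : (complex.Re (f t) ^+ 2 + complex.Im (f t) ^+ 2)^-1 @[t --> F] -->
          (complex.Re l ^+ 2 + complex.Im l ^+ 2)^-1.
  apply: (cvgV n0); apply: cvgD; rewrite !expr2.
    by apply: cvgM.
  by apply: cvgM.
split.
  by under eq_fun do rewrite RE; rewrite RE; exact: cvgM.
by under eq_fun do rewrite IE; rewrite IE; apply: cvgN; exact: cvgM.
Qed.

Lemma cvgC_sum I (r : seq I) (P : pred I) (f : I -> R -> C) (l : I -> C) :
  (forall i, cvgC F (f i) (l i)) ->
  cvgC F (fun t => \sum_(i <- r | P i) f i t) (\sum_(i <- r | P i) l i).
Proof.
move=> fl; elim: r => [|x r IH].
  by under eq_fun do rewrite big_nil; rewrite big_nil; exact: cvgC_cst.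
under eq_fun do rewrite big_cons; rewrite big_cons.
by case: (P x) => //; exact: cvgCD.
Qed.

Lemma cvgC_prod I (r : seq I) (P : pred I) (f : I -> R -> C) (l : I -> C) :
  (forall i, cvgC F (f i) (l i)) ->
  cvgC F (fun t => \prod_(i <- r | P i) f i t) (\prod_(i <- r | P i) l i).
Proof.
move=> fl; elim: r => [|x r IH].
  by under eq_fun do rewrite big_nil; rewrite big_nil; exact: cvgC_cst.
under eq_fun do rewrite big_cons; rewrite big_cons.
by case: (P x) => //; exact: cvgCM.
Qed.

(** One of the two real coordinates of [l] is nonzero, and that coordinate of [f] stays nonzero
    along the filter. *)
Lemma cvgC_neq0 f l : l != 0 -> cvgC F f l -> \forall t \near F, f t != 0.
Proof.
move=> l0 [fa fb]; have [r0|r0] := eqVneq (complex.Re l) 0.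
  have i0 : complex.Im l != 0.
    apply: contraNneq l0 => i0; apply/eqP.
    by move: r0 i0; case: (l) => a b /= -> ->.
  have : \forall t \near F, complex.Im (f t) != 0 by exact: (cvgr_neq0 _ fb i0).
  by apply: filterS => t; apply: contraNneq => ->.
have : \forall t \near F, complex.Re (f t) != 0 by exact: (cvgr_neq0 _ fa r0).
by apply: filterS => t; apply: contraNneq => ->.
Qed.

End ComplexLimits.

(** * Entrywise limits of matrices *)

Section MatrixLimits.
Variable R : realType.
Local Notation C := R[i].
Definition mxcvg (F : set_system R) m n (f : R -> 'M[C]_(m, n))
    (L : 'M[C]_(m, n)) : Prop :=
  forall i j, cvgC F (fun t => f t i j) (L i j).

Context {F : set_system R} {FF : Filter F}.

Lemma mxcvg_cst m n (L : 'M[C]_(m, n)) : mxcvg F (fun=> L) L.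
Proof. by move=> i j; exact: cvgC_cst. Qed.

Lemma mxcvgD m n f g (L K : 'M[C]_(m, n)) : mxcvg F f L -> mxcvg F g K ->
  mxcvg F (fun t => f t + g t) (L + K).
Proof.
move=> fL gK i j; under eq_fun do rewrite mxE; rewrite mxE; exact: cvgCD.
Qed.

Lemma mxcvgZ m n (f : R -> C) l g (L : 'M[C]_(m, n)) : cvgC F f l -> mxcvg F g L ->
  mxcvg F (fun t => f t *: g t) (l *: L).
Proof.
move=> fL gK i j; under eq_fun do rewrite mxE; rewrite mxE; exact: cvgCM.
Qed.

Lemma mxcvgM m n p f g (L : 'M[C]_(m, n)) (K : 'M[C]_(n, p)) :
  mxcvg F f L -> mxcvg F g K -> mxcvg F (fun t => f t *m g t) (L *m K).
Proof.
move=> fL gK i j; under eq_fun do rewrite mxE; rewrite mxE.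
by apply: cvgC_sum => k; exact: cvgCM.
Qed.

Lemma mxcvg_adj m n f (L : 'M[C]_(m, n)) :
  mxcvg F f L -> mxcvg F (fun t => (f t) ^t*) (L ^t*).
Proof.
move=> fL i j; under eq_fun do rewrite !mxE; rewrite !mxE; exact: cvgC_conj.
Qed.

Lemma mxcvg_det n f (L : 'M[C]_n) :
  mxcvg F f L -> cvgC F (fun t => \det (f t)) (\det L).
Proof.
move=> fL; apply: cvgC_sum => s; apply: cvgCM; first exact: cvgC_cst.
by apply: cvgC_prod.
Qed.

Lemma mxcvg_cofactor n f (L : 'M[C]_n) i j :
  mxcvg F f L -> cvgC F (fun t => cofactor (f t) i j) (cofactor L i j).
Proof.
move=> fL; apply: cvgCM; first exact: cvgC_cst.
apply: mxcvg_det => k l; rewrite !mxE; under eq_fun do rewrite !mxE.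
exact: fL.
Qed.

Lemma mxcvg_unit n f (L : 'M[C]_n) : L \in unitmx -> mxcvg F f L ->
  \forall t \near F, f t \in unitmx.
Proof.
rewrite unitmxE unitfE => L0 fL; near=> t; rewrite unitmxE unitfE.
near: t; exact: (cvgC_neq0 L0 (mxcvg_det fL)).
Unshelve. all: by end_near. Qed.

Lemma cvgC_near_eq (f g : R -> C) l : (\forall t \near F, f t = g t) ->
  cvgC F g l -> cvgC F f l.
Proof.
move=> fg [gr gi]; split.
  by apply: cvg_trans gr; apply: near_eq_cvg; move: fg; apply: filterS => t ->.
by apply: cvg_trans gi; apply: near_eq_cvg; move: fg; apply: filterS => t ->.
Qed.

(** Cramer's rule: the inverse is the adjugate over the determinant, both polynomial in the entries.
    The formula is only used near the limit, where [f t] is invertible and [invmx] is not the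
    default. *)
Lemma mxcvg_inv n f (L : 'M[C]_n) : L \in unitmx -> mxcvg F f L ->
  mxcvg F (fun t => invmx (f t)) (invmx L).
Proof.
move=> uL fL i j.
apply: (@cvgC_near_eq _ (fun t => (\det (f t))^-1 * cofactor (f t) j i)).
  by move: (mxcvg_unit uL fL); apply: filterS => t ut; rewrite /invmx ut !mxE.
rewrite /invmx uL !mxE; apply: cvgCM; last exact: mxcvg_cofactor.
by apply: cvgCV; [rewrite -unitfE -unitmxE|exact: mxcvg_det].
Qed.

Lemma cvgC_ntr n f (L : 'M[C]_n) :
  mxcvg F f L -> cvgC F (fun t => ntr (f t)) (ntr L).
Proof.
by move=> fL; apply: cvgCM; [exact: cvgC_cst|exact: cvgC_sum].
Qed.

End MatrixLimits.

(** * Derivatives of matrix-valued functions of a real variable *)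

Section MatrixDerivatives.
Variable R : realType.
Local Notation C := R[i].

Lemma cvgC_real (F : set_system R) {FF : Filter F} (f : R -> R) (l : R) :
  f t @[t --> F] --> l -> cvgC F (fun t => (f t)%:C%C) l%:C%C.
Proof. by move=> fl; split=> //; exact: cvg_cst. Qed.

Lemma mxcvg_near_eq (F : set_system R) {FF : Filter F} m n
    (f g : R -> 'M[C]_(m, n)) L : (\forall t \near F, f t = g t) ->
  mxcvg F g L -> mxcvg F f L.
Proof.
move=> fg gL i j; apply: cvgC_near_eq (gL i j).
by move: fg; apply: filterS => t ->.
Qed.

Lemma cvg_id_dnbhs0 : (t : R) @[t --> (0 : R)^'] --> (0 : R).
Proof. by apply: cvg_within_filter; exact: cvg_id. Qed.

(** The base point is fixed at 0 because every directional derivative is taken along a line h -> h u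
    + z. The punctured neighbourhood is the one in the definition of ['D_u]. *)
Definition mxderiv m n (f : R -> 'M[C]_(m, n)) (L : 'M[C]_(m, n)) : Prop :=
  mxcvg (0 : R)^' (fun h => (h^-1)%:C%C *: (f h - f 0)) L.

(** Differentiability implies continuity: f h is h times the difference quotient, plus f 0. *)
Lemma mxderiv_cvg m n (f : R -> 'M[C]_(m, n)) L :
  mxderiv f L -> mxcvg (0 : R)^' f (f 0).
Proof.
move=> fL; have -> : f 0 = 0%:C%C *: L + f 0 by rewrite scale0r add0r.
apply: (@mxcvg_near_eq _ _ _ _ _
    (fun h => h%:C%C *: ((h^-1)%:C%C *: (f h - f 0)) + f 0)).
  near=> h; have h0 : h != 0 by near: h; exact: nbhs_dnbhs_neq.
  by rewrite scalerA -rmorphM divff// scale1r subrK.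
apply: mxcvgD; last exact: mxcvg_cst.
by apply: mxcvgZ fL; apply: cvgC_real; exact: cvg_id_dnbhs0.
Unshelve. all: by end_near. Qed.

Lemma mxderivM m n p f g (L : 'M[C]_(m, n)) (K : 'M[C]_(n, p)) :
  mxderiv f L -> mxderiv g K ->
  mxderiv (fun t => f t *m g t) (L *m g 0 + f 0 *m K).
Proof.
move=> fL gK; rewrite /mxderiv.
under eq_fun => h.
  have -> : (h^-1)%:C%C *: (f h *m g h - f 0 *m g 0) =
      (* The factors keep their order; the first summand has [g] at h, whence the appeal to the
         continuity of [g]. *)
      ((h^-1)%:C%C *: (f h - f 0)) *m g h + f 0 *m ((h^-1)%:C%C *: (g h - g 0)).
    rewrite -scalemxAl -scalemxAr -scalerDr mulmxBl mulmxBr.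
    by rewrite addrA subrK.
  over.
apply: mxcvgD; apply: mxcvgM => //; last exact: mxcvg_cst.
exact: mxderiv_cvg gK.
Qed.

Lemma mxderiv_adj m n f (L : 'M[C]_(m, n)) :
  mxderiv f L -> mxderiv (fun t => (f t) ^t*) (L ^t*).
Proof.
move=> fL; rewrite /mxderiv.
under eq_fun => h.
  have -> : (h^-1)%:C%C *: ((f h) ^t* - (f 0) ^t*) =
      ((h^-1)%:C%C *: (f h - f 0)) ^t*.
    rewrite adjmxZ adjmxB; congr (_ *: _).
    by rewrite -[RHS]/(conjc (h^-1)%:C%C) conjc_real.
  over.
exact: mxcvg_adj.
Qed.

Lemma mxcvg_line n (B : 'M[C]_n) v :
  mxcvg (0 : R)^' (fun h => B - (h%:C%C * v)%:M) B.
Proof.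
have {2}-> : B = B + (0%:C%C : C) *: (- v)%:M by rewrite scale0r addr0.
have lineE (h : R) : B - (h%:C%C * v)%:M = B + (h%:C%C : C) *: (- v)%:M.
  by rewrite scale_scalar_mx mulrN raddfN.
under eq_fun do rewrite lineE.
apply: mxcvgD; first exact: mxcvg_cst.
apply: mxcvgZ; last exact: mxcvg_cst.
by apply: cvgC_real; exact: cvg_id_dnbhs0.
Qed.

(* The resolvent identity [G_h - G_0 = h v G_h G_0]. *)
Lemma mxderiv_resolvent n (B : 'M[C]_n) v : B \in unitmx ->
  mxderiv (fun h => invmx (B - (h%:C%C * v)%:M)) (v *: (invmx B *m invmx B)).
Proof.
move=> uB; have lB := mxcvg_line B v; rewrite /mxderiv.
apply: (@mxcvg_near_eq _ _ _ _ _
    (fun h => v *: (invmx (B - (h%:C%C * v)%:M) *m invmx B))).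
  near=> h; have h0 : h != 0 by near: h; exact: nbhs_dnbhs_neq.
  have uh : B - (h%:C%C * v)%:M \in unitmx.
    by near: h; exact: mxcvg_unit lB.
  rewrite mul0r raddf0 subr0.
  set G := invmx (B - _).
  have -> : G - invmx B = G *m (B - (B - (h%:C%C * v)%:M)) *m invmx B.
    by rewrite mulmxBr mulmxBl mulmxK// mulVmx// mul1mx.
  rewrite subKr mul_mx_scalar -scalemxAl scalerA mulrA -rmorphM.
  by rewrite mulVf// mul1r.
apply: mxcvgZ; first exact: cvgC_cst.
by apply: mxcvgM; [exact: mxcvg_inv|exact: mxcvg_cst].
Unshelve. all: by end_near. Qed.

(** Transfers a matrix derivative to the directional derivative of a real function. The value at h =
    0 is a separate hypothesis, since the punctured neighbourhood omits it. *)
Lemma derive_Re_ntr n N (phi : 'rV[R]_n.+1 -> R) z u (F : R -> 'M[C]_N) L :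
  (\forall h \near (0 : R)^', phi (h *: u + z) = complex.Re (ntr (F h))) ->
  phi z = complex.Re (ntr (F 0)) -> mxderiv F L ->
  'D_u (phi : _ -> R^o) z = complex.Re (ntr L).
Proof.
move=> phiF phiF0 FL; apply: cvg_lim => //.
have [ReL _] := cvgC_ntr FL; apply: cvg_trans ReL; apply: near_eq_cvg.
move: phiF; apply: filterS => h phiF /=.
rewrite phiF phiF0 ntrZ ntrD ntrN ReM/= mul0r subr0 raddfB.
by [].
Qed.

End MatrixDerivatives.

(** * First and second derivatives of the shape function *)

Section Hessian.
Variable R : realType.
Local Notation C := R[i].

Lemma mxderivZ m n a (f : R -> 'M[C]_(m, n)) L :
  mxderiv f L -> mxderiv (fun t => a *: f t) (a *: L).
Proof.
move=> fL; rewrite /mxderiv.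
under eq_fun do rewrite -scalerBr scalerA mulrC -scalerA.
by apply: mxcvgZ fL; exact: cvgC_cst.
Qed.

(** Identifies the plane with the complex numbers, so that a direction enters the resolvent
    derivative as a complex factor. *)
Definition cplx (z : 'rV[R]_2) : C := Complex (z 0 0) (z 0 1).

Lemma cplx_line h u z : cplx (h *: u + z) = h%:C%C * cplx u + cplx z.
Proof.
by apply/eqP; rewrite /cplx eq_complex/= !mxE !mul0r subr0 addr0 !eqxx.
Qed.

Lemma cplx_delta0 : cplx 'e_0 = 1.
Proof. by rewrite /cplx !mxE. Qed.

Lemma cplx_delta1 : cplx 'e_1 = 'i%C.
Proof. by rewrite /cplx !mxE. Qed.

Lemma subr_cplx_line N (A : 'M[C]_N) h u z :
  A - (cplx (h *: u + z))%:M = A - (cplx z)%:M - (h%:C%C * cplx u)%:M.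
Proof. by rewrite cplx_line raddfD opprD addrA addrAC. Qed.

Lemma Re_add_conj (z : C) : complex.Re (z + z^*) = complex.Re (2 * z).
Proof. by rewrite mulr_natl mulr2n; case: z. Qed.

(** The two terms of the product rule for M M^*, with a M M as derivative of M, have conjugate
    traces, so the real part doubles. *)
Lemma Re_ntr_derive_sqr N (M : 'M[C]_N) a :
  complex.Re (ntr (a *: (M *m M) *m M ^t* + M *m (a *: (M *m M)) ^t*)) =
  complex.Re (ntr ((2 * a) *: (M *m M *m M ^t*))).
Proof.
have conjE : ntr (M *m (a *: (M *m M)) ^t*) = (a * ntr (M *m M *m M ^t*))^*.
  by rewrite -ntrZ -ntr_adj [in RHS]scalemxAl [in RHS]adjmxM trmxCK.
by rewrite ntrD conjE -scalemxAl !ntrZ Re_add_conj mulrA.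
Qed.

(** Stated at every [z] where the resolvent exists, not only at the origin, so that the formula can
    be differentiated once more. *)
Lemma derive_shape_fun N (A : 'M[C]_N) z u :
  let M := invmx (A - (cplx z)%:M) in
  A - (cplx z)%:M \in unitmx ->
  'D_u (shape_fun A : _ -> R^o) z =
  complex.Re (ntr ((2 * cplx u) *: (M *m M *m M ^t*))).
Proof.
rewrite /=; set B := A - (cplx z)%:M; set M := invmx B => uB.
set F := fun h : R => invmx (B - (h%:C%C * cplx u)%:M).
have F0 : F 0 = M by rewrite /F mul0r raddf0 subr0.
have dF : mxderiv F (cplx u *: (M *m M)) by exact: mxderiv_resolvent.
rewrite (derive_Re_ntr (F := fun h => F h *m (F h) ^t*) _ _
  (mxderivM dF (mxderiv_adj dF))).
- by rewrite F0 Re_ntr_derive_sqr.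
- near=> h; rewrite /shape_fun -/(cplx _) subr_cplx_line -/B absmx_expN2E//.
  by near: h; exact: (mxcvg_unit uB (mxcvg_line _ _)).
- by rewrite F0 /shape_fun absmx_expN2E.
Unshelve. all: by end_near. Qed.

Definition shape_p N (A : 'M[C]_N) : C :=
  let M := invmx A in ntr (M *m M *m (M *m M) ^t*).

Definition shape_q N (A : 'M[C]_N) : C :=
  let M := invmx A in ntr (M *m M *m M *m M ^t*).

(** Product rule for M M M^*: the two factors M each contribute [a] times the q-moment, and the
    adjoint factor contributes [a^*] times the p-moment. *)
Lemma ntr_derive_cube N (M : 'M[C]_N) a :
  ntr ((a *: (M *m M) *m M + M *m (a *: (M *m M))) *m M ^t* +
       M *m M *m (a *: (M *m M)) ^t*) =
  2 * a * ntr (M *m M *m M *m M ^t*) + a^* * ntr (M *m M *m (M *m M) ^t*).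
Proof.
rewrite ntrD adjmxZ -[in X in _ + X]scalemxAr ntrZ; congr (_ + _).
rewrite -scalemxAl -scalemxAr (mulmxA M) -scalerDl -scalemxAl ntrZ.
by rewrite (mulr_natl a) mulr2n.
Qed.

Lemma derive2_shape_fun N (A : 'M[C]_N) u w : A \in unitmx ->
  'D_w (fun z => 'D_u (shape_fun A : _ -> R^o) z) 0 =
  complex.Re (2 * cplx u * (2 * cplx w * shape_q A + (cplx w)^* * shape_p A)).
Proof.
move=> uA; set M := invmx A.
set F := fun h : R => invmx (A - (h%:C%C * cplx w)%:M).
have cplx0 : cplx 0 = 0 by apply/eqP; rewrite eq_complex/= !mxE eqxx.
have F0 : F 0 = M by rewrite /F mul0r raddf0 subr0.
have dF : mxderiv F (cplx w *: (M *m M)) by exact: mxderiv_resolvent.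
rewrite (derive_Re_ntr (F := fun h => (2 * cplx u) *: (F h *m F h *m (F h) ^t*))
  _ _ (mxderivZ _ (mxderivM (mxderivM dF dF) (mxderiv_adj dF)))).
- by rewrite F0 ntrZ ntr_derive_cube.
- near=> h; rewrite derive_shape_fun.
    by rewrite subr_cplx_line cplx0 raddf0 subr0.
  rewrite subr_cplx_line cplx0 raddf0 subr0.
  by near: h; exact: (mxcvg_unit uA (mxcvg_line _ _)).
- by rewrite F0 derive_shape_fun cplx0 raddf0 subr0.
Unshelve. all: by end_near. Qed.

Lemma shape_pE N (A : 'M[C]_N) : shape_p A = (complex.Re (shape_p A))%:C%C.
Proof. exact: ntr_mulmx_adj_real. Qed.

(** The directions are 1 and i. In the second derivative the p-term u w^* gives a multiple of the
    identity, and the q-term u w a traceless symmetric matrix. *)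
Lemma shape_hessianE N (A : 'M[C]_N) : A \in unitmx ->
  let p := complex.Re (shape_p A) in let q := shape_q A in
  [/\ shape_hessian A 0 0 = 2 * p + 4 * complex.Re q,
      shape_hessian A 0 1 = - (4 * complex.Im q),
      shape_hessian A 1 0 = - (4 * complex.Im q)
    & shape_hessian A 1 1 = 2 * p - 4 * complex.Re q].
Proof.
move=> uA p q.
have entryE i j : shape_hessian A i j = complex.Re (2 * cplx 'e_j *
    (2 * cplx 'e_i * q + (cplx 'e_i)^* * p%:C%C)).
  by rewrite mxE derive2_shape_fun// shape_pE.
rewrite !entryE cplx_delta0 cplx_delta1 rmorph1 conjCi.
move: p q {entryE} => p [a b].
by split; rewrite /= ?(mul0r, mulr0, add0r, addr0, subr0); ring.
Qed.

End Hessian.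

(** * Eigenvalues of the Hessian and the formula for the shape parameter *)

Section ShapeParameter.
Variable R : realType.
Local Notation C := R[i].

Lemma eigenvalue_det0 (F : fieldType) n (H : 'M[F]_n) l :
  eigenvalue H l = (\det (H - l%:M) == 0).
Proof.
by rewrite /eigenvalue /eigenspace kermx_eq0 row_free_unit unitmxE unitfE negbK.
Qed.

Lemma det2 (F : comNzRingType) (H : 'M[F]_2) :
  \det H = H 0 0 * H 1 1 - H 0 1 * H 1 0.
Proof.
rewrite (expand_det_row _ 0) !big_ord_recl big_ord0 /cofactor !det_mx11 !mxE.
rewrite /= !expr0 expr1 mulN1r mul1r addr0 mulrN.
by congr (_ * H _ _ - H _ _ * H _ _); apply/val_inj.
Qed.

(** The characteristic polynomial is (l - s)^2 - (a^2 + b^2). *)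
Lemma eigenvalue_traceless_shift (H : 'M[R]_2) (s a b r : R) :
  H 0 0 = s + a -> H 0 1 = - b -> H 1 0 = - b -> H 1 1 = s - a ->
  r ^+ 2 = a ^+ 2 + b ^+ 2 ->
  [set l | eigenvalue H l] = [set s - r; s + r].
Proof.
move=> H00 H01 H10 H11 r2; apply/seteqP.
have charE l : eigenvalue H l = ((l - (s - r)) * (l - (s + r)) == 0).
  rewrite eigenvalue_det0 det2 !mxE/= H00 H01 H10 H11 mulr0n mulr1n.
  have -> : (s + a - l) * (s - a - l) - (- b - 0) * (- b - 0) =
      (l - s) ^+ 2 - (a ^+ 2 + b ^+ 2) by ring.
  by rewrite -r2; congr (_ == 0); ring.
split=> l /=; rewrite charE mulf_eq0 !subr_eq0.
  by move=> /orP[]/eqP->; [left|right].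
by move=> [] ->; rewrite eqxx ?orbT.
Qed.

Lemma sup_set2 (x y : R) : x <= y -> sup [set x; y] = y.
Proof.
move=> xy; have yub : ubound [set x; y] y by move=> z [] ->.
apply/eqP; rewrite eq_le ge_sup//=; last by exists y; right.
by apply: ub_le_sup; [exists y|right].
Qed.

Lemma inf_set2 (x y : R) : x <= y -> inf [set x; y] = x.
Proof.
move=> xy; have xlb : lbound [set x; y] x by move=> z [] ->.
apply/eqP; rewrite eq_le lb_le_inf//= ?andbT; last by exists x; left.
by apply: ge_inf; [exists x|left].
Qed.

(** This is |q| as a real number: the norm of [R[i]] takes its values in [R[i]], and [complex.Re]
    only changes the type. *)
Definition shape_r N (A : 'M[C]_N) : R := complex.Re `|shape_q A|.

Lemma shape_r_norm N (A : 'M[C]_N) : (shape_r A)%:C%C = `|shape_q A|.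
Proof. by rewrite -complex_ge0_Re. Qed.

Lemma shape_r_ge0 N (A : 'M[C]_N) : 0 <= shape_r A.
Proof. by rewrite -ler0c shape_r_norm. Qed.

Lemma shape_r_sqr N (A : 'M[C]_N) :
  shape_r A ^+ 2 = complex.Re (shape_q A) ^+ 2 + complex.Im (shape_q A) ^+ 2.
Proof.
by apply: complexI; rewrite add_Re2_Im2 -shape_r_norm rmorphXn.
Qed.

(** p is the normalized squared Hilbert-Schmidt norm of M M, which is invertible and hence nonzero
    in positive size. *)
Lemma shape_p_gt0 N (A : 'M[C]_N) : (0 < N)%N -> A \in unitmx ->
  0 < complex.Re (shape_p A).
Proof.
case: N A => // N A _ uA; rewrite lt_def -ler0c -shape_pE ntr_mulmx_adj_ge0.
rewrite andbT; apply/eqP => p0.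
have : shape_p A = 0 by rewrite shape_pE p0.
move=> /ntr_mulmx_adj_eq0 MM0.
have := unitmx_mul (invmx A) (invmx A); rewrite MM0 unitmx_inv uA.
by rewrite unitmxE det0 unitr0.
Qed.

Lemma alphaE N (A : 'M[C]_N) : (0 < N)%N -> A \in unitmx ->
  alpha A = (complex.Re (shape_p A) - 2 * shape_r A) /
            (complex.Re (shape_p A) + 2 * shape_r A).
Proof.
move=> N0 uA; have [H00 H01 H10 H11] := shape_hessianE uA.
have p0 := shape_p_gt0 N0 uA; have r0 := shape_r_ge0 A.
have r2 : (4 * shape_r A) ^+ 2 =
    (4 * complex.Re (shape_q A)) ^+ 2 + (4 * complex.Im (shape_q A)) ^+ 2.
  by rewrite !exprMn shape_r_sqr mulrDr.
rewrite /alpha /lambda1 /lambda2.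
rewrite (eigenvalue_traceless_shift H00 H01 H10 H11 r2).
move: (complex.Re (shape_p A)) (shape_r A) p0 r0 {H00 H01 H10 H11 r2} => p r p0 r0.
have le : 2 * p - 4 * r <= 2 * p + 4 * r by lra.
rewrite sup_set2// inf_set2//.
by field; apply/andP; split; apply: lt0r_neq0; lra.
Qed.

End ShapeParameter.

(** * Bounds on the shape parameter, normal matrices and the equality case *)

Section NormalShape.
Variable R : realType.
Local Notation C := R[i].

(** With r = |q|, one has 1 + alpha = 2p / (p + 2r) > 0 and 1 - alpha = 4r / (p + 2r) >= 0. *)
Lemma alpha_itv N (A : 'M[C]_N) : (0 < N)%N -> A \in unitmx ->
  -1 < alpha A <= 1.
Proof.
move=> N0 uA; rewrite alphaE//; have := shape_p_gt0 N0 uA.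
have := shape_r_ge0 A.
move: (complex.Re (shape_p A)) (shape_r A) => p r r0 p0.
have d0 : 0 < p + 2 * r by lra.
by rewrite ltr_pdivlMr// ler_pdivrMr//; apply/andP; split; lra.
Qed.

Lemma normalmx_inv n (A : 'M[C]_n) : A \in unitmx ->
  A *m A ^t* = A ^t* *m A ->
  invmx A *m (invmx A) ^t* = (invmx A) ^t* *m invmx A.
Proof.
move=> uA nA; rewrite -invmx_adj -!invmxM ?adjmx_unit//.
by rewrite nA.
Qed.

Lemma complex_polar (z : C) : exists2 l : C, `|l| = 1 & z = l * `|z|.
Proof.
have [->|z0] := eqVneq z 0; first by exists 1; rewrite ?normr1// normr0 mulr0.
exists (z / `|z|); last by rewrite mulfVK// normr_eq0.
by rewrite normf_div normr_id divff// normr_eq0.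
Qed.

(** Expansion of the squared norm of X - l Y for a phase [l], as in the proof of the Cauchy-Schwarz
    inequality. *)
Lemma ntr_sub_scale N (X Y : 'M[C]_N) l : `|l| = 1 ->
  ntr ((X - l *: Y) *m (X - l *: Y) ^t*) =
  ntr (X *m X ^t*) + ntr (Y *m Y ^t*) -
  (l^* * ntr (X *m Y ^t*) + l * (ntr (X *m Y ^t*))^*).
Proof.
move=> l1; have ll : l * l^* = 1 by rewrite -normCK l1 expr1n.
have YX : ntr (Y *m X ^t*) = (ntr (X *m Y ^t*))^*.
  by rewrite -ntr_adj [in RHS]adjmxM trmxCK.
rewrite adjmxB adjmxZ -YX.
move: (X ^t*) (Y ^t*) => X' Y'.
rewrite mulmxBl !mulmxBr -!scalemxAl -!scalemxAr scalerA ll scale1r.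
by rewrite !(ntrD, ntrN, ntrZ); ring.
Qed.

(* The Cauchy-Schwarz defect of the pair [M M], [M M^*]: for normal [M] both
   matrices have the same Hilbert-Schmidt norm, and their inner product is
   [shape_q A]. *)
Lemma normal_shape_defect N (A : 'M[C]_N) : A \in unitmx ->
  A *m A ^t* = A ^t* *m A -> let M := invmx A in
  exists2 l : C, `|l| = 1 &
    let Z := M *m M - l *: (M *m M ^t*) in
    ntr (Z *m Z ^t*) = (2 * (complex.Re (shape_p A) - shape_r A))%:C%C.
Proof.
move=> uA nA M; have nM : M *m M ^t* = M ^t* *m M by exact: normalmx_inv.
(* Taking for [l] the phase of q makes both cross terms of the expansion equal to |q|. *)
have [l l1 ql] := complex_polar (shape_q A); exists l => //=.
have ll : l * l^* = 1 by rewrite -normCK l1 expr1n.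
have YE : (M *m M ^t*) ^t* = M *m M ^t* by rewrite adjmxM trmxCK.
have pE : ntr (M *m M ^t* *m (M *m M ^t*)) = shape_p A.
  rewrite /shape_p -/M adjmxM; move: (M ^t*) nM => M' nM; congr ntr.
  by rewrite -!mulmxA; congr (_ *m _); rewrite !mulmxA -nM.
have qE : ntr (M *m M *m (M *m M ^t*)) = shape_q A.
  by congr ntr; exact: mulmxA.
have XE : ntr (M *m M *m (M *m M) ^t*) = shape_p A := erefl.
rewrite (ntr_sub_scale _ _ l1) YE pE qE XE.
have lq : l^* * shape_q A = (shape_r A)%:C%C.
  by rewrite ql mulrA [l^* * l]mulrC ll mul1r shape_r_norm.
have lqc : l * (shape_q A)^* = (shape_r A)%:C%C.
  by rewrite -[l]conjCK -rmorphM lq; exact: conjc_real.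
rewrite lq lqc shape_pE; move: (complex.Re _) (shape_r A) => p r.
by apply/eqP; rewrite eq_complex /=; apply/andP; split; apply/eqP; ring.
Qed.

Lemma shape_r_le_p N (A : 'M[C]_N) : A \in unitmx ->
  A *m A ^t* = A ^t* *m A -> shape_r A <= complex.Re (shape_p A).
Proof.
move=> uA nA; have [l _ /= ZE] := normal_shape_defect uA nA.
by have := ntr_mulmx_adj_ge0 (invmx A *m invmx A - l *: (invmx A *m invmx A ^t*));
  rewrite ZE ler0c pmulr_rge0 ?subr_ge0.
Qed.

(** The defect vanishes, so M M = l M M^*. Cancelling M on the left and inverting M = l M^* gives
    the phase [l^-1] for [A]. *)
Lemma shape_r_eq_p N (A : 'M[C]_N) : A \in unitmx ->
  A *m A ^t* = A ^t* *m A -> complex.Re (shape_p A) = shape_r A ->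
  exists2 l : C, `|l| = 1 & A = l *: A ^t*.
Proof.
move=> uA nA pr; have [l l1 /= ZE] := normal_shape_defect uA nA.
move: ZE; rewrite pr subrr mulr0 => /ntr_mulmx_adj_eq0/eqP.
have uM : invmx A \in unitmx by rewrite unitmx_inv.
have l0 : l != 0 by rewrite -normr_eq0 l1 oner_eq0.
rewrite subr_eq0 scalemxAr => /eqP /(can_inj (mulKmx uM)) ME.
exists l^-1; first by rewrite normfV l1 invr1.
rewrite -{1}[A]invmxK {1}ME invmxZ -?ME// -invmx_adj invmxK.
by [].
Qed.

(** Inverting the relation gives M^* = l M, so p and q are phases times the same moment of M^4; as p
    is nonnegative, it equals |q|. *)
Lemma shape_r_eq_p_of_phase N (A : 'M[C]_N) (l : C) : A \in unitmx ->
  `|l| = 1 -> A = l *: A ^t* -> complex.Re (shape_p A) = shape_r A.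
Proof.
move=> uA l1 AE; apply: complexI; rewrite shape_r_norm -shape_pE.
have l0 : l != 0 by rewrite -normr_eq0 l1 oner_eq0.
have MsE : (invmx A) ^t* = l *: invmx A.
  rewrite -invmx_adj {2}AE invmxZ -?AE//.
  by rewrite scalerA divff// scale1r.
have pE : shape_p A = ntr (invmx A *m invmx A *m (l *: invmx A *m (l *: invmx A))).
  by rewrite -MsE -adjmxM; exact: erefl.
have qE : shape_q A = ntr (invmx A *m invmx A *m invmx A *m (l *: invmx A)).
  by rewrite -MsE; exact: erefl.
have p_ge0 : 0 <= shape_p A by exact: ntr_mulmx_adj_ge0.
rewrite -[LHS](ger0_norm p_ge0) pE qE; move: (invmx A) => M.
rewrite -!(scalemxAl, scalemxAr) !ntrZ !normrM l1 !mul1r.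
by rewrite (mulmxA (M *m M)).
Qed.

(** alpha + 1/3 = 4(p - r) / (3(p + 2r)), so the bound is r <= p, and equality in it is p = r. *)
Lemma alpha_normal_ge N (A : 'M[C]_N) : (0 < N)%N -> A \in unitmx ->
  A *m A ^t* = A ^t* *m A -> - (1 / 3) <= alpha A.
Proof.
move=> N0 uA nA; rewrite alphaE//; have := shape_p_gt0 N0 uA.
have := shape_r_ge0 A; have := shape_r_le_p uA nA.
move: (complex.Re (shape_p A)) (shape_r A) => p r rp r0 p0.
by rewrite ler_pdivlMr; lra.
Qed.

Lemma alpha_eqN13 N (A : 'M[C]_N) : (0 < N)%N -> A \in unitmx ->
  alpha A = - (1 / 3) <-> complex.Re (shape_p A) = shape_r A.
Proof.
move=> N0 uA; rewrite alphaE//; have := shape_p_gt0 N0 uA.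
have := shape_r_ge0 A.
move: (complex.Re (shape_p A)) (shape_r A) => p r r0 p0.
have d0 : p + 2 * r != 0 by apply: lt0r_neq0; lra.
split=> [/(canRL (mulfVK d0)) E|E]; [by lra|subst p].
by field; apply: lt0r_neq0; lra.
Qed.

Lemma norm_expi (phi : R) : `|expi phi| = 1.
Proof. by rewrite normc_def /= cos2Dsin2 sqrtr1. Qed.

Lemma expi_surj (z : C) : `|z| = 1 ->
  exists2 phi : R, 0 <= phi < 2 * pi & z = expi phi.
Proof.
case: z => x y; rewrite normc_def /= => -[] xy1.
have pi0 := pi_gt0 R.
have xy : x ^+ 2 + y ^+ 2 = 1.
  by rewrite -[LHS]sqr_sqrtr ?addr_ge0 ?sqr_ge0// xy1 expr1n.
have y2 := sqr_ge0 y.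
have x1 : -1 <= x <= 1.
  by rewrite -ler_norml -[leRHS]normr1 -ler_sqr ?nnegrE// !real_normK ?num_real//; lra.
have sinE : sin (acos x) = `|y|.
  by rewrite sin_acos// -sqrtr_sqr; congr Num.sqrt; lra.
have a0 := acos_ge0 x1; have api := acos_lepi x1.
have [y0|y0] := leP 0 y.
  exists (acos x); first by apply/andP; split; lra.
  by rewrite /expi acosK// sinE ger0_norm.
(* On the lower half circle the angle is reflected. It stays strictly below 2 pi because [acos x] =
   0 would force y = 0. *)
exists (2 * pi - acos x).
  rewrite subr_ge0 ltrBlDr ltrDl; apply/andP; split; first by lra.
  rewrite lt_def a0 andbT; apply: contraTneq y0 => ac0.
  by move: sinE; rewrite ac0 sin0 => /esym/normr0_eq0 ->; rewrite ltxx.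
have -> : 2 * pi - acos x = - acos x + pi *+ 2 by rewrite mulr2n; ring.
by rewrite /expi cosD2pi sinD2pi cosN sinN acosK// sinE ltr0_norm// opprK.
Qed.

End NormalShape.

(** * Matrices realizing the prescribed values *)

Section Realization.
Variable R : realType.
Local Notation C := R[i].

Lemma CritP N (c : R) (A : 'M[C]_N) : Crit N c A ->
  [/\ A \in unitmx, ntr (invmx A *m (invmx A) ^t*) = 1
    & ntr (invmx A *m invmx A *m (invmx A) ^t*) = 0].
Proof. by case=> uA _ _; rewrite absmx_expN2E// invmx_adj. Qed.

(** The constant is chosen above 1 and above both operator norms, which leaves the trace identities
    to be checked on examples. *)
Lemma Crit_intro N (A : 'M[C]_N) : A \in unitmx ->
  ntr (invmx A *m (invmx A) ^t*) = 1 ->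
  ntr (invmx A *m invmx A *m (invmx A) ^t*) = 0 ->
  exists2 c : R, 1 < c & Crit N c A.
Proof.
move=> uA A2 A3.
have boundP (s t : R) :
    [/\ 1 < 2 + `|s| + `|t|, s <= 2 + `|s| + `|t| & t <= 2 + `|s| + `|t|].
  have := normr_ge0 s; have := normr_ge0 t.
  by have := ler_norm s; have := ler_norm t; split; lra.
have [c1 cA cM] := boundP (opnorm A) (opnorm (invmx A)).
exists (2 + `|opnorm A| + `|opnorm (invmx A)|); first exact: c1.
split; [exact: uA|exact: cA|exact: cM| |].
  by rewrite absmx_expN2E.
by rewrite invmx_adj.
Qed.

Lemma ntr_scalar N (a : C) : (0 < N)%N -> ntr (a%:M : 'M[C]_N) = a.
Proof.
move=> N0; rewrite /ntr mxtrace_scalar -[a *+ N]mulr_natl mulKf//.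
by rewrite pnatr_eq0 -lt0n.
Qed.

(** Cancelling D D^* = 1 in the moments of a unitary D = M reduces p to 1 and q to the second moment
    of the spectrum of D. *)
Lemma shape_unitary N (D : 'M[C]_N) : (0 < N)%N -> D *m D ^t* = 1%:M ->
  let A := D ^t* in
  [/\ A \in unitmx, A *m A ^t* = A ^t* *m A, invmx A = D,
      shape_p A = 1 & shape_q A = ntr (D *m D)].
Proof.
move=> N0 DD A; have uA : A \in unitmx by have [] := mulmx1_unit DD.
have AD : A *m D = 1%:M by exact: mulmx1C.
have MD : invmx A = D by apply: (can_inj (mulKmx uA)); rewrite mulmxV.
split=> //.
- by rewrite /A trmxCK DD.
- rewrite /shape_p MD adjmxM (mulmxA (D *m D)) -(mulmxA D D) DD mulmx1 DD.
  exact: ntr_scalar.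
- by rewrite /shape_q MD -(mulmxA (D *m D)) DD mulmx1.
Qed.

(** The spectrum is the vertex set of a rectangle centred at 0. Opposite points cancel the first
    moment; conjugate points make the second moment real, namely Re(u^2). *)
Definition rectangle_mx (u : C) : 'M[C]_4 :=
  diag_mx (\row_i nth 0 [:: u; - u; u^*; - u^*] i).

Lemma ntr_rectangle_mx (u : C) : ntr (rectangle_mx u) = 0.
Proof.
rewrite /ntr mxtrace_diag !big_ord_recl big_ord0 !mxE /= addr0.
by rewrite addrA subrr add0r subrr mulr0.
Qed.

Lemma ntr_rectangle_mx_sqr (u : C) :
  ntr (rectangle_mx u *m rectangle_mx u) = (u ^+ 2 + u^* ^+ 2) / 2.
Proof.
rewrite /ntr mulmx_diag mxtrace_diag !big_ord_recl big_ord0 !mxE /= addr0.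
by rewrite !mulrNN -!expr2; field.
Qed.

Lemma rectangle_mx_unitary (u : C) : `|u| = 1 ->
  rectangle_mx u *m (rectangle_mx u) ^t* = 1%:M.
Proof.
move=> u1; have uu : u * u^* = 1 by rewrite -normCK u1 expr1n.
have uu' : u^* * (u^*)^* = 1 by rewrite conjCK mulrC.
rewrite tr_diag_mx map_diag_mx mulmx_diag -diag_const_mx; congr diag_mx.
apply/rowP => -[i /= i4]; rewrite !mxE/=.
case: i i4 => [|[|[|[|?]]]] // _ /=;
  by rewrite ?rmorphN ?mulrNN ?uu//; exact: uu'.
Qed.

(** For unitary M the moment of M M M^* is the trace of M, which vanishes by the central symmetry of
    the spectrum. *)
Lemma Crit_rectangle (u : C) : `|u| = 1 ->
  exists2 c : R, 1 < c & Crit 4 c ((rectangle_mx u) ^t*).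
Proof.
move=> u1; have DD := rectangle_mx_unitary u1.
have [uA _ MD _ _] := shape_unitary (N := 4) isT DD.
apply: Crit_intro => //; rewrite MD.
  by rewrite DD ntr_scalar.
by rewrite -mulmxA DD mulmx1 ntr_rectangle_mx.
Qed.

Lemma alpha_normal_surj (a : R) : - (1 / 3) <= a <= 1 ->
  exists A : 'M[C]_4, [/\ exists2 c : R, 1 < c & Crit 4 c A,
    A *m A ^t* = A ^t* *m A & alpha A = a].
Proof.
move=> /andP[a13 a1].
have a1_gt0 : 0 < 1 + a by lra.
(* The solution of (1 - 2r) / (1 + 2r) = a; the bound a >= -1/3 becomes r <= 1. *)
pose r := (1 - a) / (2 * (1 + a)).
have r0 : 0 <= r by rewrite divr_ge0//; lra.
have r1 : r <= 1 by rewrite ler_pdivrMr; lra.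
(* Chosen so that x^2 + y^2 = 1 and Re(u^2) = x^2 - y^2 = r for u = x + i y. *)
pose x := Num.sqrt ((1 + r) / 2); pose y := Num.sqrt ((1 - r) / 2).
have x2 : x ^+ 2 = (1 + r) / 2 by rewrite sqr_sqrtr//; lra.
have y2 : y ^+ 2 = (1 - r) / 2 by rewrite sqr_sqrtr//; lra.
pose u : C := Complex x y.
have u1 : `|u| = 1.
  by rewrite normc_def /= x2 y2 -mulrDl addrACA subrr addr0 divff// sqrtr1.
have DD := rectangle_mx_unitary u1.
have [uA nA MD pE qE] := shape_unitary (N := 4) isT DD.
exists ((rectangle_mx u) ^t*); split; [exact: Crit_rectangle|exact: nA|].
have rE : shape_r ((rectangle_mx u) ^t*) = r.
  rewrite /shape_r qE ntr_rectangle_mx_sqr.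
  have -> : (u ^+ 2 + u^* ^+ 2) / 2 = r%:C%C.
    have -> : u ^+ 2 + u^* ^+ 2 = 2 * r%:C%C.
      rewrite !expr2; apply/eqP; rewrite eq_complex/=.
      by apply/andP; split; apply/eqP; lra.
    by rewrite mulrC mulKf// pnatr_eq0.
  by rewrite ger0_norm ?ler0c.
rewrite (alphaE (N := 4) isT uA) rE pE /= /r.
by field; apply/andP; split; apply: lt0r_neq0; lra.
Qed.

(** Shows that the union in (iii) is nonempty. For u = 1 the spectrum is 1, -1, hence real. *)
Lemma Crit_hermitian_exists : exists A : 'M[C]_4,
  (exists2 c : R, 1 < c & Crit 4 c A) /\ A = A ^t*.
Proof.
exists ((rectangle_mx 1) ^t*); split; first exact/Crit_rectangle/normr1.
rewrite trmxCK tr_diag_mx map_diag_mx; congr diag_mx; apply/rowP => -[i i4].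
by rewrite !mxE /=; case: i i4 => [|[|[|[|?]]]] // _ /=; rewrite ?rmorphN ?rmorph1.
Qed.

Definition antidiag_mx (x y : R) : 'M[C]_2 :=
  \matrix_(i, j) (if (i == 0) && (j == 1) then x%:C%C
                  else if (i == 1) && (j == 0) then y%:C%C else 0).

Lemma ntr_antidiag_mx x y : ntr (antidiag_mx x y) = 0.
Proof. by rewrite /ntr /mxtrace !big_ord_recl big_ord0 !mxE /= !addr0 mulr0. Qed.

Lemma antidiag_mx_sqr x y :
  antidiag_mx x y *m antidiag_mx x y = ((x * y)%:C%C)%:M.
Proof.
apply/matrixP => i j; rewrite !mxE !big_ord_recl big_ord0 !mxE.
by case: i => [[|[|//]] ?]; case: j => [[|[|//]] ?] /=;
  rewrite !(mul0r, mulr0, add0r, addr0) ?mulr0n ?mulr1n// -rmorphM// mulrC.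
Qed.

Lemma ntr_antidiag_mx_adj x y : x ^+ 2 + y ^+ 2 = 2 ->
  ntr (antidiag_mx x y *m (antidiag_mx x y) ^t*) = 1.
Proof.
move=> xy2; rewrite ntr_mulmx_adj !big_ord_recl !big_ord0 !mxE /=.
rewrite !normr0 !expr0n/= !addr0 !add0r.
rewrite -!add_Re2_Im2 /= !expr0n /= !addr0 -rmorphD xy2.
by rewrite rmorph_nat mulVf// pnatr_eq0.
Qed.

(** Here M M is the scalar s = x y. Hence the moment of M M M^* is s times the conjugate of tr M =
    0, while p = s^2 and q = s, because M M^* has normalized trace 1. *)
Lemma alpha_antidiag (x y : R) : 0 < x -> 0 < y -> x ^+ 2 + y ^+ 2 = 2 ->
  let A := invmx (antidiag_mx x y) in
  (exists2 c : R, 1 < c & Crit 2 c A) /\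
  alpha A = (x * y - 2) / (x * y + 2).
Proof.
move=> x0 y0 xy2 A; have s0 : 0 < x * y by exact: mulr_gt0.
have sC0 : (x * y)%:C%C != 0 :> C.
  by rewrite -[0]/(0%:C%C : C) (inj_eq (@complexI _)) gt_eqF.
have M2 := antidiag_mx_sqr x y; have trM := ntr_antidiag_mx x y.
have trMM := ntr_antidiag_mx_adj xy2.
have AM : invmx A = antidiag_mx x y by exact: invmxK.
have uA : A \in unitmx.
  rewrite unitmx_inv; have : antidiag_mx x y *m antidiag_mx x y \in unitmx.
    by rewrite M2 unitmxE det_scalar unitfE expf_neq0.
  by rewrite unitmx_mul => /andP[].
split.
  apply: Crit_intro; [exact: uA|by rewrite AM|].
  by rewrite AM M2 mul_scalar_mx ntrZ ntr_adj trM rmorph0 mulr0.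
have pE : shape_p A = ((x * y) ^+ 2)%:C%C.
  rewrite /shape_p AM M2 mul_scalar_mx ntrZ ntr_adj ntr_scalar//.
  by rewrite rmorphXn expr2; congr (_ * _); exact: conjc_real.
have qE : shape_q A = (x * y)%:C%C.
  by rewrite /shape_q AM M2 mul_scalar_mx -scalemxAl ntrZ trMM mulr1.
have rE : shape_r A = x * y.
  by rewrite /shape_r qE ger0_norm// ler0c ltW.
rewrite alphaE// pE rE /=; move: (x * y) s0 => s s0.
by field; apply/andP; split; apply: lt0r_neq0; nra.
Qed.

Lemma alpha_low_surj (a : R) : -1 < a <= - (1 / 3) ->
  exists A : 'M[C]_2, (exists2 c : R, 1 < c & Crit 2 c A) /\ alpha A = a.
Proof.
move=> /andP[a1 a13].
have a1_gt0 : 0 < 1 - a by lra.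
(* The solution of (s - 2) / (s + 2) = a; the range of [a] becomes 0 < s <= 1. *)
pose s := 2 * (1 + a) / (1 - a).
have s0 : 0 < s by rewrite divr_gt0//; lra.
have s1 : s <= 1 by rewrite ler_pdivrMr; lra.
(* With x^2 = 1 + w and y^2 = 1 - w the sum of squares is 2 and (x y)^2 = 1 - w^2 = s^2; s > 0 gives
   w < 1 and so y > 0. *)
pose w := Num.sqrt (1 - s ^+ 2).
have w2 : w ^+ 2 = 1 - s ^+ 2 by rewrite sqr_sqrtr//; nra.
have w0 : 0 <= w by exact: sqrtr_ge0.
have w1 : w < 1 by nra.
pose x := Num.sqrt (1 + w); pose y := Num.sqrt (1 - w).
have x0 : 0 < x by rewrite sqrtr_gt0; lra.
have y0 : 0 < y by rewrite sqrtr_gt0; lra.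
have xy2 : x ^+ 2 + y ^+ 2 = 2 by rewrite !sqr_sqrtr; lra.
have xyE : x * y = s.
  rewrite -sqrtrM; last by lra.
  have -> : (1 + w) * (1 - w) = s ^+ 2 by rewrite mulrC -subr_sqr expr1n w2 subKr.
  by rewrite sqrtr_sqr gtr0_norm.
have [cA aA] := alpha_antidiag x0 y0 xy2.
exists (invmx (antidiag_mx x y)); split=> //.
rewrite aA xyE /s; field.
by apply/andP; split; apply: lt0r_neq0; lra.
Qed.

End Realization.

(** * The three value sets and the characterization of equality *)

Theorem lemma2p6 (R : realType) :
  [/\ [set a : R | -1 < a <= 1] =
        \bigcup_(N in [set N | (0 < N)%N]) \bigcup_(c in [set c : R | 1 < c])
          [set alpha A | A in Crit N c],
      [set a : R | - (1 / 3) <= a <= 1] =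
        \bigcup_(N in [set N | (0 < N)%N]) \bigcup_(c in [set c : R | 1 < c])
          [set alpha A | A in [set A | Crit N c A /\
                                       A *m A ^t* = A ^t* *m A]],
      [set - (1 / 3) : R] =
        \bigcup_(N in [set N | (0 < N)%N]) \bigcup_(c in [set c : R | 1 < c])
          [set alpha A | A in [set A | Crit N c A /\ A = A ^t*]]
    & forall (N : nat) (c : R) (A : 'M[R[i]]_N),
        (0 < N)%N -> 1 < c -> Crit N c A -> A *m A ^t* = A ^t* *m A ->
        (alpha A = - (1 / 3) <->
         exists2 phi : R, 0 <= phi < 2 * pi & A = expi phi *: A ^t*)].
Proof.
split.
- apply/seteqP; split=> [a /= /andP[a1 a2]|a [N /= N0 [c /= c1 [A AC <-]]]].
    (* Values up to -1/3 come from the antidiagonal family, the larger ones from the unitary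
       diagonal family. *)
    have [a13|a13] := leP a (- (1 / 3)).
      have [|A [[c c1 AC] aA]] := @alpha_low_surj R a; first by rewrite a1.
      by exists 2%N => //; exists c => //; exists A.
    have [|A [[c c1 AC] _ aA]] := @alpha_normal_surj R a.
      by rewrite a2 andbT ltW.
    by exists 4%N => //; exists c => //; exists A.
  by have [uA _ _] := CritP AC; exact: alpha_itv.
- apply/seteqP; split=> [a /= a13|a [N /= N0 [c /= c1 [A [AC nA] <-]]]].
    have [A [[c c1 AC] nA aA]] := alpha_normal_surj a13.
    by exists 4%N => //; exists c => //; exists A.
  have [uA _ _] := CritP AC; rewrite alpha_normal_ge//=.
  by have /andP[] := alpha_itv N0 uA.
(* A Hermitian matrix is the case of phase 1 in the equality criterion. *)
- have hermE N (A : 'M[R[i]]_N) : (0 < N)%N -> A \in unitmx -> A = A ^t* ->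
      alpha A = - (1 / 3).
    move=> N0 uA AA; apply/alpha_eqN13 => //.
    by apply: (@shape_r_eq_p_of_phase _ _ _ 1); rewrite ?normr1 ?scale1r.
  apply/seteqP; split=> [a /= ->|a [N /= N0 [c /= c1 [A [AC AA] <-]]]].
    have [A [[c c1 AC] AA]] := Crit_hermitian_exists R.
    exists 4%N => //; exists c => //; exists A => //.
    by have [uA _ _] := CritP AC; exact: hermE.
  by have [uA _ _] := CritP AC; exact: hermE.
- move=> N c A N0 c1 AC nA; have [uA _ _] := CritP AC.
  split=> [/(alpha_eqN13 N0 uA) pr|[phi _ AE]].
    have [l l1 AE] := shape_r_eq_p uA nA pr.
    by have [phi phi2pi lE] := expi_surj l1; exists phi => //; rewrite -lE.
  by apply/alpha_eqN13 => //; exact: shape_r_eq_p_of_phase (norm_expi phi) AE.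
Qed.
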